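(* Let $(u_n)_{n=0}^{\infty}$ and $(w_n)_{n=0}^{\infty}$ be real sequences such that $w_n\le u_n$ for all $n\in\mathbb{N}\cup\{0\}$. Suppose additionally that for every $n\in\mathbb{N}$ and every choice of coefficients $p_0,\dots,p_{n-1}$, $q$, $r_{n+1},r_{n+2},\dots$ in $\mathbb{D}$ satisfying $$\sum_{i=0}^{n-1}p_i+q+\sum_{i=n+1}^{\infty}r_i=1$$ and such that some $p_i$ is non-zero if and only if some $r_i$ is non-zero, the inequality $$w_n\le\sum_{i=0}^{n-1}p_i\,u_i+q\,u_n+\sum_{i=n+1}^{\infty}r_i\,u_i$$ holds (whenever the series on the right converges). Then there exists a convex sequence $(v_n)_{n=0}^{\infty}$ such that $w_n\le v_n\le u_n$ for all $n\in\mathbb{N}\cup\{0\}$.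
   Context: $\mathbb{N}$ denotes the set of positive integers. A real sequence $(v_n)_{n=0}^{\infty}$ is called convex if $2v_n\le v_{n-1}+v_{n+1}$ for all $n\in\mathbb{N}$. $\mathbb{D}$ denotes the set of non-negative proper dyadic rationals, $\mathbb{D}=\{m/2^{j} : m\in\mathbb{N}\cup\{0\},\ j\in\mathbb{N},\ m\le 2^{j}\}$. *)

(* Defs.v *)
From HB Require Import structures.
From mathcomp Require Import all_boot all_order all_algebra.
From mathcomp Require Import all_classical all_reals all_analysis.
Set Implicit Arguments.
Unset Strict Implicit.
Unset Printing Implicit Defensive.
Import Order.TTheory GRing.Theory Num.Theory.
Import numFieldNormedType.Exports.
Local Open Scope ring_scope.

Definition convex_seq (R : realType) (v : nat -> R) : Prop :=
  forall n : nat, (0 < n)%N -> 2 * v n <= v n.-1 + v n.+1.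

Definition proper_dyadic (R : realType) : set R :=
  [set x | exists m j : nat,
     [/\ (0 < j)%N, (m <= 2 ^ j)%N & x = m%:R / 2 ^+ j]]%classic.

Definition summable_from (R : realType) (m : nat) (a : nat -> R) : Prop :=
  cvgn (fun N : nat => \sum_(m <= i < N) a i).

(* A junk value unless [summable_from m a]. *)
Definition sum_from (R : realType) (m : nat) (a : nat -> R) : R :=
  limn (fun N : nat => \sum_(m <= i < N) a i).

(* Only the values [p i] for [i < n] and [r i] for [n < i] are relevant. *)
Definition admissible_coeffs (R : realType) (n : nat)
    (p : nat -> R) (q : R) (r : nat -> R) : Prop :=
  [/\ forall i : nat, (i < n)%N -> proper_dyadic (p i),
      proper_dyadic q,
      forall i : nat, (n < i)%N -> proper_dyadic (r i),
      summable_from n.+1 r /\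
        (\sum_(0 <= i < n) p i) + q + sum_from n.+1 r = 1
    & (exists i : nat, (i < n)%N /\ p i <> 0) <->
      (exists i : nat, (n < i)%N /\ r i <> 0)].

(* Main.v *)
Require Import Defs.
From HB Require Import structures.
From mathcomp Require Import all_boot all_order all_algebra.
From mathcomp Require Import all_classical all_reals all_analysis.
From mathcomp Require Import lra.
Import Order.TTheory GRing.Theory Num.Theory.
Import numFieldNormedType.Exports.
Local Open Scope ring_scope.

(** The admissible weights are tied together only by their total mass: nothing
    forces their barycentre to be [n].  So for [i < n < k] the inequality
    [w n <= (1 - t) * u i + t * u k] is available for every [t = 2 ^ -j] and
    also for [t = 1 - 2 ^ -j].  Letting [j] grow, all the mass moves to one of
    the two points, whence [w n <= u i] for every [i < n] and [w n <= u k] for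
    every [k > n] ([le_two_points], [le_of_dyadic_mixtures]).  With the
    hypothesis [w n <= u n], every [w n] with [n > 0] is a lower bound of all
    the values of [u].

    Hence [c], the infimum of the values of [u], is finite and separates
    [w] from [u] at all positive indices.  The index [0] is exceptional, since
    [w 0] may exceed [c]; there the value [u 0] is taken.  The sequence
    [u 0, c, c, ...] is convex because [c <= u 0]. *)

Lemma sum_nat_one_term {V : nmodType} {m n : nat} (k : nat) {a : nat -> V} :
  (m <= k < n)%N -> (forall i, i != k -> a i = 0) ->
  \sum_(m <= i < n) a i = a k.
Proof.
move=> kmn a0; rewrite (bigD1_seq k) ?mem_index_iota ?iota_uniq //=.
by rewrite big1 ?addr0.
Qed.

Lemma cvg_sum_one_term {R : realType} {m k : nat} {a : nat -> R} :
  (m <= k)%N -> (forall i, i != k -> a i = 0) ->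
  ((fun N => \sum_(m <= i < N) a i) @ \oo --> a k)%classic.
Proof.
move=> mk a0; apply: cvg_near_cst; exists k.+1 => // N /= kN.
by apply: sum_nat_one_term; rewrite ?mk.
Qed.

Lemma proper_dyadic_half_pow {R : realType} {j : nat} :
  (0 < j)%N -> @proper_dyadic R (2 ^- j).
Proof. by move=> j0; exists 1%N, j; rewrite expn_gt0 mul1r. Qed.

Lemma proper_dyadic_onem_half_pow {R : realType} {j : nat} :
  (0 < j)%N -> @proper_dyadic R (1 - 2 ^- j).
Proof.
move=> j0; exists (2 ^ j - 1)%N, j; split=> //; first exact: leq_subr.
by rewrite natrB ?expn_gt0 // natrX mulrBl mul1r divff.
Qed.

Lemma proper_dyadic0 {R : realType} : @proper_dyadic R 0.
Proof. by exists 0%N, 1%N; rewrite mul0r. Qed.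

Lemma half_pow_lt1 {R : realType} {j : nat} : (0 < j)%N -> 2 ^- j < 1 :> R.
Proof. by move=> j0; rewrite invf_lt1 ?exprn_gt0// exprn_egt1 ?ltr1n// -lt0n. Qed.

(** Both weights have to be non-zero: mass on one side of [n] is admissible
    only in the presence of mass on the other side. *)
Lemma le_two_points {R : realType} {u : nat -> R} {x : R} {n i k : nat}
    {s t : R} :
  (forall (p : nat -> R) (q : R) (r : nat -> R),
     admissible_coeffs n p q r ->
     summable_from n.+1 (fun i : nat => r i * u i) ->
     x <= (\sum_(0 <= i < n) p i * u i) + q * u n
          + sum_from n.+1 (fun i : nat => r i * u i)) ->
  (i < n)%N -> (n < k)%N -> proper_dyadic s -> proper_dyadic t ->
  s != 0 -> t != 0 -> s + t = 1 -> x <= s * u i + t * u k.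
Proof.
move=> hx ltin ltnk ds dt s0 t0 st1.
pose p l : R := if l == i then s else 0.
pose r l : R := if l == k then t else 0.
have pE l : l != i -> p l = 0 by rewrite /p => /negbTE ->.
have rE l : l != k -> r l = 0 by rewrite /r => /negbTE ->.
have puE l : l != i -> p l * u l = 0 by move=> /pE ->; rewrite mul0r.
have ruE l : l != k -> r l * u l = 0 by move=> /rE ->; rewrite mul0r.
have cr := cvg_sum_one_term ltnk rE.
have cru := cvg_sum_one_term ltnk ruE.
have pi : p i = s by rewrite /p eqxx.
have rk : r k = t by rewrite /r eqxx.
have adm : admissible_coeffs n p 0 r.
  split.
  - by move=> l _; rewrite /p; case: ifP => // _; exact: proper_dyadic0.
  - exact: proper_dyadic0.
  - by move=> l _; rewrite /r; case: ifP => // _; exact: proper_dyadic0.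
  - split; first by apply/cvg_ex; exists (r k).
    rewrite /sum_from (cvg_lim _ cr)// (sum_nat_one_term i)//.
    by rewrite pi rk addr0.
  - by split=> _; [exists k|exists i]; split=> //; apply/eqP; rewrite ?pi ?rk.
have := hx _ _ _ adm; rewrite /sum_from (cvg_lim _ cru)//.
rewrite (sum_nat_one_term i)// pi rk mul0r addr0; apply.
by apply/cvg_ex; exists (r k * u k); exact: cru.
Qed.

Lemma le_of_dyadic_mixtures {R : realType} {x a : R} (b : R) :
  (forall j : nat, (0 < j)%N -> x <= (1 - 2 ^- j) * a + 2 ^- j * b) -> x <= a.
Proof.
move=> h.
have lim0 : ((fun j => 2 ^- j.+1 : R) @ \oo --> (0 : R))%classic.
  have := @cvg_geometric R 2^-1 2^-1.
  rewrite ger0_norm// invf_lt1// ltr1n => /(_ isT).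
  by apply: cvg_trans; apply: near_eq_cvg; near=> j; rewrite /= exprVn -invfM -exprS.
have lim : ((fun j => (1 - 2 ^- j.+1) * a + 2 ^- j.+1 * b) @ \oo -->
    (1 - 0) * a + 0 * b)%classic.
  by apply: cvgD; apply: cvgMr_tmp => //; apply: cvgB => //; exact: cvg_cst.
rewrite subr0 mul1r mul0r addr0 in lim.
rewrite -(cvg_lim _ lim)//; apply: limr_ge; first by apply/cvg_ex; exists a.
by near=> j; exact: h.
Unshelve. all: by end_near. Qed.

Theorem proposition2p3 (R : realType) (u w : nat -> R)
  (hwu : forall n : nat, w n <= u n)
  (hw : forall n : nat, (0 < n)%N ->
    forall (p : nat -> R) (q : R) (r : nat -> R),
      admissible_coeffs n p q r ->
      summable_from n.+1 (fun i : nat => r i * u i) ->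
      w n <= (\sum_(0 <= i < n) p i * u i) + q * u n
             + sum_from n.+1 (fun i : nat => r i * u i)) :
  exists v : nat -> R,
    convex_seq v /\ forall n : nat, w n <= v n /\ v n <= u n.
Proof.
have wlb n m : (0 < n)%N -> w n <= u m.
  move=> n0.
  have two i k s t := @le_two_points R u (w n) n i k s t (hw n n0).
  have [ltmn|ltnm|<-] := ltngtP m n; last exact: hwu.
  (* For [m < n] the vanishing mass [2 ^- j] sits at [n.+1]; for [n < m] it
     sits at [0], which lies below [n] because [n] is positive. *)
  - apply: (le_of_dyadic_mixtures (u n.+1)) => j j0.
    apply: two => //; rewrite ?subrK//.
    + exact: proper_dyadic_onem_half_pow.
    + exact: proper_dyadic_half_pow.
    + by rewrite subr_eq0 gt_eqF ?half_pow_lt1.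
  - apply: (le_of_dyadic_mixtures (u 0%N)) => j j0.
    rewrite addrC; apply: two => //; rewrite ?subrKC//.
    + exact: proper_dyadic_half_pow.
    + exact: proper_dyadic_onem_half_pow.
    + by rewrite subr_eq0 gt_eqF ?half_pow_lt1.
pose c := inf (range u).
have cu m : c <= u m.
  by apply: ge_inf; [exists (w 1%N) => _ [k _ <-]; exact: wlb|exists m].
have wc n : (0 < n)%N -> w n <= c.
  move=> n0; apply: lb_le_inf; first by exists (u 0%N), 0%N.
  by move=> _ [k _ <-]; exact: wlb.
exists (fun n => if n is 0 then u 0%N else c); split.
  by move=> [|[|n]] //= _; have := cu 0%N; lra.
by move=> [|n]; split=> //; exact: wc.
Qed.
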